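(* Let $k$ be a field of characteristic not $2$, let $V$ be a finite-dimensional vector space over $k$ (of arbitrary dimension), and let $Q$ be a nondegenerate quadratic form on $V$. Let $t\in SO(Q)$ be a semisimple element. Then $t$ is real in $SO(Q)$ if and only if $t$ is strongly real in $SO(Q)$.
   Context: $SO(Q)$ is the group of $k$-linear isometries of $(V,Q)$ of determinant $1$. A linear transformation is semisimple if it is diagonalizable over an algebraic closure $\bar k$. An element $t$ of a group $\mathcal G$ is real in $\mathcal G$ if it is conjugate to $t^{-1}$ in $\mathcal G$; an involution is an element $s$ with $s^2=1$ (the identity is allowed); $t$ is strongly real in $\mathcal G$ if it is a product of two involutions of $\mathcal G$. *)

(* Defs.v *)
From mathcomp Require Import all_boot all_order all_algebra.

Set Implicit Arguments.
Unset Strict Implicit.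
Unset Printing Implicit Defensive.

Import GRing.Theory.
Local Open Scope ring_scope.

Section QuadraticForms.
Variables (k : fieldType) (V : vectType k).
Implicit Types (Q : V -> k) (t : 'End(V)).

Definition polar Q (u v : V) : k := Q (u + v) - Q u - Q v.

Definition quadratic_form Q : Prop :=
  (forall (a : k) (v : V), Q (a *: v) = a ^+ 2 * Q v) /\
  bilinear_for *%R *%R (polar Q).

Definition nondegenerate_form Q : Prop :=
  forall u : V, (forall v : V, polar Q u v = 0) -> u = 0.

(* The properties of this matrix used below (determinant, diagonalizability)
   do not depend on the choice of the basis. It acts on row vectors. *)
Definition end_mx t : 'M[k]_(\dim {:V}) := passmx.mxof (vbasis {:V}) (vbasis {:V}) t.

Definition special_orthogonal Q t : Prop :=
  (forall v : V, Q (t v) = Q v) /\ \det (end_mx t) = 1.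

(* The closed field K, with its embedding iota of k, is an algebraic closure
   of k: it is algebraic over k. *)
Definition semisimple t : Prop :=
  exists (K : closedFieldType) (iota : {rmorphism k -> K}),
    (forall x : K, algebraicOver iota x) /\
    diagonalizable (map_mx iota (end_mx t)).

(* In the next three definitions, G is meant to be a group of automorphisms
   of V under composition; on automorphisms, (_^-1)%VF is the inverse. *)
Implicit Types G : 'End(V) -> Prop.

Definition real_in G t : Prop :=
  exists2 g, G g & (g \o t \o g^-1)%VF = (t^-1)%VF.

Definition involution_in G (s : 'End(V)) : Prop :=
  G s /\ (s \o s)%VF = \1%VF.

Definition strongly_real_in G t : Prop :=
  exists s1 s2, [/\ involution_in G s1, involution_in G s2
                  & t = (s1 \o s2)%VF].

End QuadraticForms.

(* Main.v *)
Require Import Defs.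
From mathcomp Require Import all_boot all_order all_algebra.
From mathcomp Require Import separable ring.

(* If [t = s1 s2] with involutions [s1] and [s2], then [s1] conjugates [t] to
   its inverse. Conversely, as [t] is semisimple, the algebra [k[t]] is reduced,
   which allows to write [V] as an orthogonal sum of nondegenerate cyclic
   modules [k[t] v]; the maps [p(t) v |-> p(t^-1) v] on the summands are the
   restrictions of an isometric involution [s] with [t s t = s], and
   [t = s (s t)]. It remains to have [det s = 1]. If [t] has an eigenvalue [1]
   or [-1], there is an anisotropic eigenvector [v] for it, and composing [s]
   with the reflection along [v] changes the sign of [det s]. Otherwise, if [g]
   in [SO(Q)] conjugates [t] to its inverse, then [g s] is an isometry commuting
   with [t], and all such isometries have determinant [1]: over the algebraic
   closure, they preserve the sum [L] of the eigenspaces for half of the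
   eigenvalues (one of each pair [x], [1 / x]) and the sum [L'] of the others,
   and they act on [L'] as on the dual of [L].

   Matrices act on row vectors, [B] is the Gram matrix of the polar form. *)

Set Implicit Arguments.
Unset Strict Implicit.
Unset Printing Implicit Defensive.

Import GRing.Theory passmx.
Local Open Scope ring_scope.

(** * Separability of the minimal polynomial and regularity of [k[T]] *)

Lemma separable_mxminpoly (k : fieldType) (K : closedFieldType)
    (iota : {rmorphism k -> K}) n (T : 'M[k]_n.+1) :
  diagonalizable (map_mx iota T) -> separable_poly (mxminpoly T).
Proof.
move=> /diagonalizableP[rs Urs]; rewrite mxminpoly_map => /dvdp_separable.
by rewrite separable_prod_XsubC separable_map => /(_ Urs).
Qed.

(** Write the minimal polynomial as [g * h] with [g] its gcd with [p]. It has no multiple factor, so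
    [h] is coprime to [p]; for [y] the Bezout coefficient of [p], the difference [p * y * p - p] is
    a multiple of [h * g]. *)
Lemma horner_mx_regular (k : fieldType) n (T : 'M[k]_n.+1) (p : {poly k}) :
  separable_poly (mxminpoly T) ->
  exists y, horner_mx T (p * y * p) = horner_mx T p.
Proof.
move=> sepT; pose g := gcdp (mxminpoly T) p; pose h := mxminpoly T %/ g.
have def_gh : mxminpoly T = g * h by rewrite mulrC divpK ?dvdp_gcdl.
have: coprimep h p.
  have d_p := dvdp_gcdr h p; have d_h := dvdp_gcdl h p.
  have d_mu : gcdp h p %| mxminpoly T.
    by rewrite (dvdp_trans d_h) // def_gh dvdp_mulIr.
  have d_g : gcdp h p %| g by rewrite dvdp_gcd d_mu.
  have /(separable_coprime sepT) : gcdp h p * gcdp h p %| mxminpoly T.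
    by rewrite def_gh dvdp_mul.
  by rewrite coprimepp /coprimep.
case/Bezout_eq1_coprimepP => -[z y] /= yz1; exists y; apply/eqP.
rewrite -subr_eq0 -rmorphB -dvd_mxminpoly def_gh.
have -> : p * y * p - p = - (z * (p * h)).
  by rewrite -mulrA -(addKr (z * h) (y * p)) yz1; ring.
by rewrite dvdpNr dvdp_mull // dvdp_mul ?dvdp_gcdr.
Qed.

(** * Cyclic modules *)

(** By Cayley-Hamilton these powers of [T] suffice for the row space to be the whole cyclic module
    [k[T] v]. *)
Definition krylov (k : fieldType) n (T : 'M[k]_n.+1) (v : 'rV_n.+1) :=
  \matrix_(i < n.+1) (v *m T ^+ i).

Lemma krylov_horner (k : fieldType) n (T : 'M[k]_n.+1) v (p : {poly k}) :
  (v *m horner_mx T p <= krylov T v)%MS.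
Proof.
rewrite (divp_eq p (char_poly T)) rmorphD rmorphM /= Cayley_Hamilton mulr0.
rewrite add0r.
have: (size (p %% char_poly T)%R <= n.+1)%N.
  by rewrite -ltnS -(size_char_poly T) ltn_modp monic_neq0 ?char_poly_monic.
set r := p %% _ => le_r_n; rewrite -[r]coefK poly_def rmorph_sum mulmx_sumr.
apply: summx_sub => i _; have lt_i_n := leq_trans (ltn_ord i) le_r_n.
rewrite /= linearZ /= rmorphXn /= horner_mx_X -scalemxAr scalemx_sub //.
by rewrite -(rowK (fun i : 'I_n.+1 => v *m T ^+ i) (Ordinal lt_i_n)) row_sub.
Qed.

Lemma krylovP (k : fieldType) n (T : 'M[k]_n.+1) (u v : 'rV_n.+1) :
  (u <= krylov T v)%MS -> exists p, u = v *m horner_mx T p.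
Proof.
case/submxP=> D ->; exists (rVpoly D); rewrite mulmx_sum_row [rVpoly D]poly_def.
rewrite rmorph_sum mulmx_sumr; apply: eq_bigr => i _.
by rewrite rowK valK /= linearZ /= rmorphXn /= horner_mx_X scalemxAr.
Qed.

Lemma krylov_stable (k : fieldType) n (T : 'M[k]_n.+1) v :
  (krylov T v *m T <= krylov T v)%MS.
Proof.
apply/row_subP=> i; rewrite row_mul rowK -mulmxA.
have -> : T ^+ i *m T = horner_mx T 'X^(i.+1).
  by rewrite rmorphXn /= horner_mx_X exprSr.
exact: krylov_horner.
Qed.

(** Equality of ranks reverses the inclusion [krylov_stable]; this yields stability under the
    inverse of [T]. *)
Lemma krylov_sub_mulr (k : fieldType) n (T : 'M[k]_n.+1) v :
  T \in unitmx -> (krylov T v <= krylov T v *m T)%MS.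
Proof.
move=> unitT; rewrite -(geq_leqif (mxrank_leqif_sup (krylov_stable T v))).
by rewrite mxrankMfree // row_free_unit.
Qed.

Lemma krylov_id (k : fieldType) n (T : 'M[k]_n.+1) v :
  (v <= krylov T v)%MS.
Proof. by have := krylov_horner T v 1; rewrite rmorph1 mulmx1. Qed.

Lemma krylov_mulr (k : fieldType) n (T : 'M[k]_n.+1) v :
  krylov T v *m T = \matrix_(i < n.+1) (v *m T ^+ i.+1).
Proof.
by apply/row_matrixP=> i; rewrite row_mul !rowK -mulmxA -[_ *m T]exprSr.
Qed.

(** * Gram matrices, adjoints and generalized inverses *)

Lemma gram_orbit (k : fieldType) n (P R : 'I_n -> 'M[k]_n) (B : 'M_n)
    (v : 'rV_n) i j :
  (\matrix_i (v *m P i) *m B *m (\matrix_j (v *m R j))^T) i j =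
  (v *m (P i *m B *m (R j)^T) *m v^T) 0 0.
Proof.
have -> (A : 'M_n) : A i j = row i A 0 j by rewrite mxE.
rewrite row_mul; set C := \matrix_j (v *m R j).
have -> (x : 'rV_n) : (x *m C^T) 0 j = (x *m (v *m R j)^T) 0 0.
  rewrite !mxE; apply: eq_bigr => l _; rewrite !mxE.
  by congr (_ * _); rewrite mxE.
by rewrite row_mul rowK trmx_mul !mulmxA.
Qed.

(** Here and below, [B *m X^T = Y *m B] expresses that [Y] is the adjoint of [X] for the form
    [B]. *)
Lemma isometry_adjoint (k : fieldType) n (B T Ti : 'M[k]_n) :
  T *m Ti = 1%:M -> T *m B *m T^T = B -> B *m Ti^T = T *m B.
Proof.
move=> TTi isoT.
by rewrite -{1}isoT -mulmxA -trmx_mul (mulmx1C TTi) trmx1 mulmx1.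
Qed.

Lemma expmx_adjoint (k : fieldType) n (S T B : 'M[k]_n.+1) i :
  B *m T^T = S *m B -> B *m (T ^+ i)^T = S ^+ i *m B.
Proof.
move=> BT; elim: i => [|i IHi]; first by rewrite !expr0 trmx1 mulmx1 mul1mx.
by rewrite exprSr trmx_mul mulmxA BT -mulmxA IHi mulmxA -[S *m _]exprS.
Qed.

Lemma row_form_sym (k : fieldType) n (A B : 'M[k]_n) (v : 'rV_n) :
  A^T = B -> (v *m A *m v^T) 0 0 = (v *m B *m v^T) 0 0.
Proof.
move=> <-; have -> : v *m A^T *m v^T = (v *m A *m v^T)^T.
  by rewrite !trmx_mul trmxK mulmxA.
by rewrite [RHS]mxE.
Qed.

Lemma mulmx_ginv_tr (k : fieldType) n (M N : 'M[k]_n) :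
  M^T = M -> M *m N *m M = M -> M *m N^T *m M = M.
Proof.
by move=> MT MNM; rewrite -[RHS]MT -[in RHS]MNM !trmx_mul MT mulmxA.
Qed.

(** [N] itself may fail to be symmetric. Replacing [C^T] by [C^T *m N *m M] in [C^T *m N^T *m C]
    makes [M *m N^T *m C = C] appear. *)
Lemma ginv_sandwich_tr (k : fieldType) m n (M N : 'M[k]_n) (C : 'M_(n, m)) :
  M^T = M -> M *m N^T *m C = C -> (C^T *m N *m C)^T = C^T *m N *m C.
Proof.
move=> MT MNC.
have CNM : C^T *m N *m M = C^T by rewrite -{2}MNC !trmx_mul trmxK MT mulmxA.
rewrite !trmx_mul trmxK mulmxA -{1}CNM -!mulmxA; congr (_ *m (_ *m _)).
by rewrite mulmxA MNC.
Qed.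

(** * Projection and inverting involution on a nondegenerate cyclic module *)

Section CyclicProjection.

Variables (k : fieldType) (n : nat) (B T Ti : 'M[k]_n.+1) (v : 'rV[k]_n.+1).
Hypotheses (unitB : B \in unitmx) (symB : B^T = B).
Hypotheses (TTi : T *m Ti = 1%:M) (isoT : T *m B *m T^T = B).

Let C := krylov T v.
Let C' := krylov Ti v.
Let M := C *m B *m C^T.

(** The rows of [C] may be dependent and [M] singular; their span is nondegenerate when each
    relation [y *m M = 0] comes from a relation [y *m C = 0]. A generalized inverse [N] then does
    the work of an inverse. *)
Hypothesis ndM : kermx M *m C = 0.

Variable N : 'M[k]_n.+1.
Hypothesis MNM : M *m N *m M = M.

(* [F] is the orthogonal projection onto the span of the [v T^i]; on this span
   [S] maps [v T^i] to [v T^-i]. *)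
Let F := B *m C^T *m N *m C.
Let S := B *m C^T *m N *m C'.

Let TiT : Ti *m T = 1%:M. Proof. exact: mulmx1C. Qed.
Let BTt : B *m T^T = Ti *m B.
Proof. by rewrite -{2}isoT !mulmxA TiT mul1mx. Qed.
Let BTit : B *m Ti^T = T *m B. Proof. exact: isometry_adjoint. Qed.

Let MT : M^T = M. Proof. by rewrite !trmx_mul trmxK symB mulmxA. Qed.

Let ker0 m (y : 'M_(m, n.+1)) : y *m M = 0 -> y *m C = 0.
Proof.
by move/sub_kermxP/submxP=> [D ->]; rewrite -mulmxA ndM mulmx0.
Qed.

Let CE : M *m N *m C = C.
Proof.
apply/eqP; rewrite -subr_eq0 -{2}[C]mul1mx -mulmxBl.
by apply/eqP/ker0; rewrite mulmxBl MNM mul1mx subrr.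
Qed.

Let CE' : M *m N^T *m C = C.
Proof.
apply/eqP; rewrite -subr_eq0 -{2}[C]mul1mx -mulmxBl.
by apply/eqP/ker0; rewrite mulmxBl mulmx_ginv_tr // mul1mx subrr.
Qed.

Let CF : C *m F = C. Proof. by rewrite /F !mulmxA CE. Qed.

Let CNC : (C^T *m N *m C)^T = C^T *m N *m C.
Proof. exact: ginv_sandwich_tr MT CE'. Qed.

Let FB : B *m F^T = F *m B.
Proof. by rewrite /F -!(mulmxA B) trmx_mul symB CNC !mulmxA. Qed.

Let FF : F *m F = F. Proof. by rewrite {1}/F -mulmxA CF. Qed.

(** Nondegeneracy of the span, in the form that reduces equalities between its vectors to pairings
    with the rows of [C]. *)
Let subF m (Y : 'M_(m, n.+1)) : Y *m F = Y -> Y *m B *m C^T = 0 -> Y = 0.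
Proof. by move=> YF E; rewrite -YF /F !mulmxA E !mul0mx. Qed.

Let CT_C : (C *m T <= C)%MS. Proof. exact: krylov_stable. Qed.

Let unitT : T \in unitmx. Proof. by case/mulmx1_unit: TTi. Qed.

Let C_CT : (C <= C *m T)%MS. Proof. exact: krylov_sub_mulr. Qed.

Let FTF : F *m T *m F = F *m T.
Proof.
case/submxP: CT_C => A CT.
by rewrite {1 3}/F -!mulmxA (mulmxA C) CT -!mulmxA CF.
Qed.

Let FTiF : F *m Ti *m F = F *m Ti.
Proof.
case/submxP: C_CT => A CT.
have CTi : C *m Ti = A *m C by rewrite {1}CT -!mulmxA TTi mulmx1.
by rewrite {1 3}/F -!mulmxA (mulmxA C) CTi -!mulmxA CF.
Qed.

(** Taking adjoints in [FTiF], where [F] is self-adjoint and [T] is the adjoint of [Ti], gives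
    [F *m T *m F = T *m F]; compare with [FTF]. *)
Let comFT : F *m T = T *m F.
Proof.
apply: (can_inj (mulmxK unitB)).
rewrite -FTF -(mulmxA _ F) -FB mulmxA -(mulmxA F T B) -BTit mulmxA -FB.
rewrite -(mulmxA B) -(trmx_mul Ti F) -(mulmxA B) -(trmx_mul F) mulmxA FTiF.
by rewrite (trmx_mul F) mulmxA BTit -mulmxA FB mulmxA.
Qed.

Let comFTi : F *m Ti = Ti *m F.
Proof.
by rewrite -[LHS]mul1mx -TiT -mulmxA (mulmxA T) -comFT -mulmxA TTi mulmx1.
Qed.

Let vF : v *m F = v.
Proof. by case/submxP: (krylov_id T v) => D ->; rewrite -mulmxA CF. Qed.

Let C'F : C' *m F = C'.
Proof.
apply/row_matrixP=> i; rewrite row_mul rowK -mulmxA.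
have -> : Ti ^+ i *m F = F *m Ti ^+ i.
  exact/commr_sym/commrX.
by rewrite mulmxA vF.
Qed.

Let SF : S *m F = S. Proof. by rewrite /S -mulmxA C'F. Qed.

Let FBC : F *m B *m C^T = B *m C^T.
Proof. by rewrite -FB -mulmxA -trmx_mul CF. Qed.

Let FS : F *m S = S.
Proof. by rewrite [in LHS]/S !mulmxA FBC. Qed.

Let H := C *m B *m C'^T.

(** On either side the entry depends only on [i + j], and the symmetry of [B] exchanges [T] and
    [Ti]. For [C'BC'] below, the difference of the exponents plays this part. *)
Let C'BC : C' *m B *m C^T = H.
Proof.
apply/matrixP=> i j; rewrite !gram_orbit -!(mulmxA _ B).
rewrite (expmx_adjoint j BTt) (expmx_adjoint j BTit) !(mulmxA (_ ^+ i)).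
apply: row_form_sym; rewrite -[_ ^+ i *m _]exprD -[T ^+ i *m _]exprD.
by rewrite trmx_mul symB (expmx_adjoint _ BTit).
Qed.

Let C'BC' : C' *m B *m C'^T = M.
Proof.
apply/matrixP=> i j; rewrite !gram_orbit -!(mulmxA _ B).
rewrite (expmx_adjoint j BTt) (expmx_adjoint j BTit) !(mulmxA (_ ^+ i)).
apply: row_form_sym; rewrite !trmx_mul symB mulmxA (expmx_adjoint j BTt).
rewrite -(mulmxA _ B) (expmx_adjoint i BTit) mulmxA; congr (_ *m _).
by apply/commrX/commr_sym/commrX; rewrite /GRing.comm [LHS]TTi.
Qed.

(** This is the well-definedness of [S]: relations between the [v T^i] also hold between the
    [v T^-i], as the pairings with [C] show. *)
Let CS : C *m S = C'.
Proof.
have CSE : C *m S = M *m N *m C' by rewrite /S !mulmxA.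
apply/eqP; rewrite -subr_eq0; apply/eqP/subF.
  by rewrite mulmxBl C'F -mulmxA SF.
by rewrite CSE !mulmxBl -!(mulmxA (M *m N)) C'BC /H !mulmxA CE subrr.
Qed.

Let SB : B *m S^T = S *m B.
Proof.
pose X := B *m C^T *m N.
have SXF : S = X *m C' *m F by rewrite -mulmxA C'F.
have SE : S *m B = X *m H *m X^T.
  rewrite {1}SXF -(mulmxA _ F) -FB -C'BC /F -/X trmx_mul.
  by rewrite !mulmxA.
have HT : H^T = H by rewrite -{1}C'BC !trmx_mul trmxK symB mulmxA.
rewrite SE -{1}symB -trmx_mul SE (trmx_mul (X *m H)) (trmx_mul X) trmxK HT.
by rewrite mulmxA.
Qed.

Let SS : S *m S = F.
Proof.
have C'S : C' *m S = C.
  apply/eqP; rewrite -subr_eq0; apply/eqP/subF.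
    by rewrite mulmxBl CF -mulmxA SF.
  rewrite !mulmxBl -(mulmxA C') -SB mulmxA -(mulmxA (C' *m B)) -(trmx_mul C).
  by rewrite CS C'BC' subrr.
by rewrite {1}/S -mulmxA C'S.
Qed.

Let TST : T *m S *m T = S.
Proof.
case/submxP: CT_C => A CT.
have AH : C *m T *m B *m C'^T = A *m H by rewrite CT -!(mulmxA A).
have AHT : C' *m B *m (C *m T)^T = C *m T *m B *m C'^T.
  apply/matrixP=> i j.
  rewrite krylov_mulr !gram_orbit -!(mulmxA _ B).
  rewrite (expmx_adjoint _ BTt) (expmx_adjoint j BTit) !(mulmxA (_ ^+ _)).
  apply: row_form_sym; rewrite -[_ ^+ i *m _]exprD -[T ^+ _ *m _]exprD.
  by rewrite trmx_mul symB (expmx_adjoint _ BTit) addnS addSn.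
(* The coefficients [A] that express the [v T^(i+1)] by the rows of [C] also express the
   [v T^-(i+1)] by those of [C']. The last row matters: its exponent exceeds all those in [C']. *)
have C'Ti : C' *m Ti = A *m C'.
  apply/eqP; rewrite -subr_eq0; apply/eqP/subF.
    by rewrite mulmxBl -!mulmxA -comFTi C'F (mulmxA C') C'F.
  rewrite !mulmxBl -(mulmxA C') -BTt -(mulmxA A) -(mulmxA A) C'BC -AH -AHT.
  by rewrite trmx_mul !mulmxA subrr.
have FTST : F *m T *m S *m T = S.
  have CTST : C *m T *m S *m T = C'.
    by rewrite CT -(mulmxA A) CS -C'Ti -mulmxA TiT mulmx1.
  by rewrite {1}/F -3!(mulmxA (B *m C^T *m N)) CTST.
by rewrite -[RHS]FTST comFT -(mulmxA T F) FS.
Qed.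

Lemma cyclic_projection : exists F S : 'M[k]_n.+1,
  [/\ [/\ F *m F = F, B *m F^T = F *m B, F *m T = T *m F
        & (F <= krylov T v)%MS],
      [/\ v *m F = v, F *m S = S & S *m F = S],
      S *m S = F, B *m S^T = S *m B & T *m S *m T = S].
Proof.
by exists F, S; split=> //; split=> //; rewrite submxMl.
Qed.

End CyclicProjection.

(** * Anisotropic vectors of symmetric forms *)

(** If [u] and [w] are isotropic, the value at [u + w] is twice their pairing. The explicit list
    lets [x] inherit linear properties, such as being an eigenvector. *)
Lemma polarization (k : fieldType) n (A : 'M[k]_n) (u w : 'rV_n) :
  2%N \notin [pchar k] -> A^T = A -> (u *m A *m w^T) 0 0 != 0 ->
  exists2 x, x \in [:: u; w; u + w] & (x *m A *m x^T) 0 0 != 0.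
Proof.
move=> char_k symA uw; have [qu|] := eqVneq ((u *m A *m u^T) 0 0) 0; last first.
  by exists u; rewrite ?inE ?eqxx.
have [qw|] := eqVneq ((w *m A *m w^T) 0 0) 0; last first.
  by exists w; rewrite ?inE ?eqxx ?orbT.
exists (u + w); first by rewrite !inE eqxx !orbT.
have wu : w *m A *m u^T = (u *m A *m w^T)^T.
  by rewrite !trmx_mul trmxK symA mulmxA.
have addE (X Y : 'M[k]_1) : (X + Y) 0 0 = X 0 0 + Y 0 0 by rewrite mxE.
have trE (X : 'M[k]_1) : X^T 0 0 = X 0 0 by rewrite mxE.
rewrite linearD /= mulmxDl mulmxDr !mulmxDl wu !addE trE qu qw add0r addr0.
by rewrite -mulr2n -mulr_natl mulf_neq0 //; move: char_k; rewrite inE.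
Qed.

Lemma symmetric_anisotropic (k : fieldType) n (A : 'M[k]_n) :
  2%N \notin [pchar k] -> A^T = A -> A != 0 ->
  exists x : 'rV_n, (x *m A *m x^T) 0 0 != 0.
Proof.
move=> char_k symA /matrix0Pn[i [j Aij]].
have uw : ((delta_mx 0 i : 'rV_n) *m A *m (delta_mx 0 j : 'rV_n)^T) 0 0 != 0.
  by rewrite -rowE trmx_delta -colE !mxE.
by have [x _ qx] := polarization char_k symA uw; exists x.
Qed.

(** * Two determinant computations *)

(** The block matrix with rows [1, y] and [x, 1] has two triangular factorizations, one for each
    side. *)
Lemma det_1_sub_mul (k : comNzRingType) n (x : 'cV[k]_n) (y : 'rV_n) :
  \det (1%:M - x *m y) = 1 - (y *m x) 0 0.
Proof.
have E1 : block_mx 1%:M y x 1%:M =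
    block_mx 1%:M 0 x 1%:M *m block_mx 1%:M y 0 (1%:M - x *m y).
  rewrite mulmx_block !(mul1mx, mulmx1, mul0mx, mulmx0, addr0, add0r).
  by rewrite addrCA subrr addr0.
have E2 : block_mx 1%:M y x 1%:M =
    block_mx (1%:M - y *m x) y 0 1%:M *m block_mx 1%:M 0 x 1%:M.
  rewrite mulmx_block !(mul1mx, mulmx1, mul0mx, mulmx0, addr0, add0r).
  by rewrite subrK.
have := E2; rewrite E1 => /(congr1 determinant).
rewrite !det_mulmx !det_lblock !det_ublock !det1 !mul1r !mulr1 => ->.
by rewrite det_mx11 !mxE.
Qed.

(** [E] and [E'] are the projections onto [L] and [L']. Then [C = X *m Y], where [X] is [C] on [L]
    and [1] on [L'], and [Y] the opposite. As [B] pairs [L] with [L'], the inverse [Z] of [Y] has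
    adjoint [X], so [X] and [Z] have the same determinant. *)
Lemma det_centralizer_diag (k : fieldType) n (d : 'rV[k]_n) (B C : 'M_n) :
    B \in unitmx -> diag_mx d *m B *m diag_mx d = B -> C *m B *m C^T = B ->
    C *m diag_mx d = diag_mx d *m C -> (forall i, d 0 i ^+ 2 != 1) ->
  \det C = 1.
Proof.
move=> unitB dBd isoC comC d2.
pose s := codom (d 0).
(* [half] selects one of each pair of distinct inverse entries of [d]. *)
pose half i := ltn (index (d 0 i) s) (index (d 0 i)^-1 s).
pose e : 'rV[k]_n := \row_i (half i)%:R.
pose E := diag_mx e; pose E' := 1%:M - E.
(* A nonzero [B i j] forces [d 0 i] and [d 0 j] to be inverse to each other; they differ since the
   square of [d 0 i] is not [1]. *)
have halfB i j : B i j != 0 -> half j = ~~ half i.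
  move=> Bij; have dij : d 0 i * d 0 j = 1.
    apply: (mulfI Bij); rewrite mulr1 mulrC -[in RHS]dBd.
    by rewrite mul_mx_diag mxE mul_diag_mx mxE mulrAC.
  have di0 : d 0 i != 0.
    by apply: contra_eq_neq dij => ->; rewrite mul0r eq_sym oner_eq0.
  have djE : d 0 j = (d 0 i)^-1 by rewrite -[RHS]mulr1 -dij mulKf.
  rewrite /half djE invrK -leqNgt leq_eqVlt [_ == _ :> nat]negbTE //=.
  have sj : (d 0 i)^-1 \in s by rewrite -djE codom_f.
  have si : d 0 i \in s by rewrite codom_f.
  apply: contra_neqN (d2 i) => /eqP/(index_inj 0 sj si) dV.
  by rewrite expr2 -{1}dV mulVf.
have EB : E *m B = B *m E'.
  apply/matrixP=> i j; rewrite mulmxBr mulmx1 mul_diag_mx mul_mx_diag !mxE.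
  have [->|/halfB->] := eqVneq (B i j) 0; first by rewrite mul0r mulr0 subrr.
  by case: (half i); rewrite ?(mulr0, mulr1, mul0r, mul1r, subr0, subrr).
have EC : E *m C = C *m E.
  apply/matrixP=> i j; rewrite mul_diag_mx mul_mx_diag !mxE mulrC.
  have [->|Cij] := eqVneq (C i j) 0; first by rewrite !mul0r.
  congr (_ * (nat_of_bool _)%:R); rewrite /half; suff -> : d 0 i = d 0 j by [].
  move/matrixP/(_ i j): comC; rewrite mul_diag_mx mul_mx_diag !mxE mulrC.
  by move/(mulIf Cij).
have EE : E *m E = E.
  apply/matrixP=> i j; rewrite mul_diag_mx !mxE.
  by case: (half i); rewrite ?(mul0r, mul1r, mul0rn).
have E'E : E' *m E = 0 by rewrite mulmxBl mul1mx EE subrr.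
have EE' : E *m E' = 0 by rewrite mulmxBr mulmx1 EE subrr.
have E'E' : E' *m E' = E' by rewrite {1}/E' mulmxBl mul1mx EE' subr0.
have Et : E^T = E by rewrite tr_diag_mx.
have E't : E'^T = E' by rewrite linearB /= trmx1 Et.
have unitC : C \in unitmx.
  move/(congr1 (fun X => \rank X)): isoC => rk; rewrite -row_full_unit.
  rewrite -col_leq_rank -{1}(mxrank_unit unitB) -rk.
  by rewrite (leq_trans (mxrankM_maxl _ _)) ?mxrankM_maxl.
pose Ci := invmx C; have CCi : C *m Ci = 1%:M by rewrite mulmxV.
have E'C : E' *m C = C *m E' by rewrite mulmxBl mulmxBr EC mul1mx mulmx1.
pose X := E *m C + E'; pose Y := E + E' *m C; pose Z := E + E' *m Ci.
have XY : X *m Y = C.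
  rewrite mulmxDl !mulmxDr E'E (mulmxA E' E') E'E' EC -!mulmxA EE (mulmxA E).
  by rewrite EE' mul0mx mulmx0 addr0 add0r E'C -mulmxDr addrC subrK mulmx1.
have YZ : Y *m Z = 1%:M.
  rewrite mulmxDl !mulmxDr EE (mulmxA E E') EE' mul0mx addr0 E'C -!mulmxA E'E.
  rewrite mulmx0 add0r (mulmxA E') E'E' mulmxA -E'C -mulmxA CCi mulmx1.
  by rewrite addrC subrK.
have XB : X *m B = B *m Z^T.
  have CB := esym (isometry_adjoint CCi isoC).
  rewrite linearD /= trmx_mul E't Et mulmxDl mulmxDr EC -!mulmxA EB !mulmxA CB.
  rewrite addrC; congr (_ + _); rewrite mulmxBl mul1mx EB mulmxBr mulmx1.
  by rewrite opprB addrC subrK.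
have detXZ : \det X = \det Z.
  move/(congr1 determinant): XB; rewrite !det_mulmx det_tr mulrC.
  move/mulfI; apply.
  by rewrite -unitfE -unitmxE.
by rewrite -XY det_mulmx detXZ mulrC -det_mulmx YZ det1.
Qed.

(** * Splitting off nondegenerate cyclic modules *)

Lemma krylov_sub (k : fieldType) n (T : 'M[k]_n.+1) v w :
  (w <= krylov T v)%MS -> (krylov T w <= krylov T v)%MS.
Proof.
case/krylovP=> p ->; apply/row_subP=> i; rewrite rowK -mulmxA.
have -> : horner_mx T p *m T ^+ i = horner_mx T (p * 'X^i).
  by rewrite rmorphM rmorphXn /= horner_mx_X.
exact: krylov_horner.
Qed.

Lemma krylov_fix (k : fieldType) n (T F : 'M[k]_n.+1) (v w : 'rV_n.+1) :
  F *m T = T *m F -> v *m F = v -> (w <= krylov T v)%MS -> w *m F = w.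
Proof.
move=> FT vF /krylovP[p ->]; rewrite -mulmxA.
have -> : horner_mx T p *m F = F *m horner_mx T p by apply: comm_horner_mx.
by rewrite mulmxA vF.
Qed.

Section InvertingInvolution.

Variables (k : fieldType) (n : nat) (B T Ti : 'M[k]_n.+1).
Hypotheses (char_k : 2%N \notin [pchar k]).
Hypotheses (unitB : B \in unitmx) (symB : B^T = B).
Hypotheses (TTi : T *m Ti = 1%:M) (isoT : T *m B *m T^T = B).
Hypothesis sepT : separable_poly (mxminpoly T).

Let BTit : B *m Ti^T = T *m B. Proof. exact: isometry_adjoint. Qed.

Let symf (x y : 'rV[k]_n.+1) : (x *m B *m y^T) = (y *m B *m x^T)^T.
Proof. by rewrite !trmx_mul trmxK symB mulmxA. Qed.

(* As [k[T]] is von Neumann regular, a nonzero vector [v p(T)] of the radical of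
   the cyclic module of [v] yields an idempotent [p y]; replacing [v] by
   [v (1 - p y)(T)] changes [v] only by a vector of the radical, and makes the
   cyclic module strictly smaller. *)
Lemma nondegenerate_krylov (v : 'rV_n.+1) :
  (v *m B *m v^T) 0 0 != 0 ->
  exists w : 'rV_n.+1, [/\ (w <= krylov T v)%MS, (w *m B *m w^T) 0 0 != 0
    & kermx (krylov T w *m B *m (krylov T w)^T) *m krylov T w = 0].
Proof.
have [r] := ubnP (\rank (krylov T v)); elim: r v => // r IHr v le_r qv.
set C := krylov T v.
have [nd | /rowV0Pn[u /submxP[D uE] u0]] :=
  eqVneq (kermx (C *m B *m C^T) *m C) 0.
  by exists v; rewrite krylov_id.
have uC : (u <= C)%MS by rewrite uE mulmxA submxMl.
have uker : (u <= kermx (B *m C^T))%MS.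
  apply/sub_kermxP; rewrite uE -mulmxA -(mulmxA _ C) (mulmxA C).
  by rewrite mulmx_ker mulmx0.
(* The orthogonal of the cyclic module is stable under [T] because the module is stable under
   [Ti]. *)
have Tker : stablemx (kermx (B *m C^T)) T.
  have unitT : T \in unitmx by case/mulmx1_unit: TTi.
  apply/sub_kermxP; case/submxP: (krylov_sub_mulr v unitT) => A CE.
  have CTi : C *m Ti = A *m C by rewrite [in LHS]/C CE -!mulmxA TTi mulmx1.
  rewrite -mulmxA (mulmxA T) -BTit -mulmxA -trmx_mul CTi trmx_mul.
  by rewrite !mulmxA -(mulmxA _ B) mulmx_ker mul0mx.
have [p uv] := krylovP uC; have [y pyp] := horner_mx_regular p sepT.
pose w := u *m horner_mx T y; pose v' := v - w.
have wE : w = v *m horner_mx T (p * y) by rewrite rmorphM mulmxA -uv.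
have wC : (w <= C)%MS by rewrite wE krylov_horner.
have w_perp x : (x <= C)%MS -> w *m B *m x^T = 0.
  case/submxP=> A ->; rewrite trmx_mul -mulmxA (mulmxA B) mulmxA.
  suff /sub_kermxP-> : (w <= kermx (B *m C^T))%MS by rewrite mul0mx.
  by rewrite (submx_trans (submxMr _ uker)) // horner_mx_stable.
have v'E : v' = v *m horner_mx T (1 - p * y).
  by rewrite rmorphB rmorph1 mulmxBr mulmx1 -wE.
have v'C : (v' <= C)%MS by rewrite v'E krylov_horner.
have qv' : (v' *m B *m v'^T) = v *m B *m v^T.
  rewrite linearB /= mulmxBr !mulmxBl [v *m B *m w^T]symf.
  by rewrite !w_perp ?krylov_id // trmx0 !subr0.
(* If [v = v' q(T)], then [u = v p(T)] equals [v] times the value at [T] of [q (p - p y p)], which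
   is zero. *)
have lt_C : (\rank (krylov T v') < \rank C)%N.
  apply: rank_ltmx; rewrite ltmxE krylov_sub //=; apply/negP=> C_v'.
  have /krylovP[q vE] := submx_trans (krylov_id T v) C_v'.
  case/eqP: u0; rewrite uv vE v'E -!mulmxA -[_ *m (_ *m _)]mulmx1.
  have -> : horner_mx T (1 - p * y) *m (horner_mx T q *m horner_mx T p) =
            horner_mx T (q * (p - p * y * p)).
    rewrite -[_ *m (_ *m _)]/(_ * (_ * _)) -!rmorphM.
    by congr (horner_mx T _); ring.
  by rewrite rmorphM /= rmorphB /= pyp subrr mulr0 mulmx0 mul0mx.
have [|w' [w'C qw' ndw']] := IHr v' (leq_trans lt_C le_r); first by rewrite qv'.
by exists w'; split=> //; apply: submx_trans w'C (krylov_sub v'C).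
Qed.

(** Induction on the rank of the orthogonal projection [F]: a nondegenerate cyclic module, with
    projection [G], is split off its image, and [F - G] is treated by induction. *)
Lemma inverting_involution_on (F : 'M_n.+1) :
    F *m F = F -> B *m F^T = F *m B -> F *m T = T *m F ->
  exists S : 'M_n.+1, [/\ F *m S = S, S *m F = S, S *m S = F,
    B *m S^T = S *m B & T *m S *m T = S].
Proof.
have [r] := ubnP (\rank F); elim: r F => // r IHr F le_r FF FB FT.
have [-> | F0] := eqVneq F 0.
  by exists 0; rewrite !(mul0mx, mulmx0, trmx0).
(* [F *m B] is the Gram matrix of the form [B] pulled back along [F]; an anisotropic [x] for it
   makes [x *m F] anisotropic for [B]. *)
have symFB : (F *m B)^T = F *m B by rewrite trmx_mul symB.
have FBn0 : F *m B != 0.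
  by apply: contraNneq F0 => FB0; rewrite -(mulmxK unitB F) FB0 mul0mx.
have [x qx] := symmetric_anisotropic char_k symFB FBn0.
have [|v [vC qv ndv]] := @nondegenerate_krylov (x *m F).
  rewrite trmx_mul -!mulmxA (mulmxA B) FB -!mulmxA (mulmxA F F) FF.
  by rewrite !mulmxA in qx *.
have xFF : x *m F *m F = x *m F by rewrite -mulmxA FF.
have vF := krylov_fix FT xFF vC.
have [|G [S0 [[GG GB GT GC] [vG GS0 S0G] S00 S0B TS0]]] :=
  @cyclic_projection k n B T Ti v unitB symB TTi isoT ndv
    (pinvmx (krylov T v *m B *m (krylov T v)^T)).
  exact: mulmxKpV.
have GF : G *m F = G.
  apply/row_matrixP=> i; rewrite row_mul; apply: krylov_fix FT vF _.
  by apply: submx_trans GC; apply: row_sub.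
have FG : F *m G = G.
  apply: (can_inj (mulmxK unitB)); rewrite -mulmxA -GB mulmxA -FB -mulmxA.
  by rewrite -trmx_mul GF.
have F'F : (F - G) *m F = F - G by rewrite mulmxBl FF GF.
have GF' : G *m (F - G) = 0 by rewrite mulmxBr GF GG subrr.
have F'G : (F - G) *m G = 0 by rewrite mulmxBl FG GG subrr.
have FF' : F *m (F - G) = F - G by rewrite mulmxBr FF FG.
have lt_F' : (\rank (F - G)%R < \rank F)%N.
  apply: rank_ltmx; rewrite ltmxE -{1}F'F submxMl /=.
  apply/negP=> /submxP[D FE].
  have G0 : G = 0 by rewrite -FG FE -mulmxA F'G mulmx0.
  by move: qv; rewrite -vG G0 mulmx0 !mul0mx mxE eqxx.
have [||| S1 [F'S1 S1F' S11 S1B TS1]] := IHr (F - G) (leq_trans lt_F' le_r).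
- by rewrite mulmxBl FF' GF' subr0.
- by rewrite linearB /= mulmxBr mulmxBl FB GB.
- by rewrite mulmxBl mulmxBr FT GT.
have S10 : S1 *m S0 = 0.
  by rewrite -S1F' -GS0 -mulmxA (mulmxA _ G) F'G mul0mx mulmx0.
have S01 : S0 *m S1 = 0.
  by rewrite -F'S1 -S0G -mulmxA (mulmxA G) GF' mul0mx mulmx0.
exists (S1 + S0); split.
- by rewrite mulmxDr -F'S1 mulmxA FF' -{1}GS0 mulmxA FG GS0.
- by rewrite mulmxDl -S1F' -mulmxA F'F -{1}S0G -mulmxA GF S0G.
- by rewrite mulmxDl !mulmxDr S10 S01 S11 S00 addr0 add0r subrK.
- by rewrite linearD /= mulmxDr mulmxDl S1B S0B.
- by rewrite mulmxDr mulmxDl TS1 TS0.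
Qed.

(** An eigenvector [u] is orthogonal to the image of [T - e%:M], which by regularity is a complement
    of the eigenspace. So [u] pairs nontrivially with some eigenvector [x], and polarization
    applies. *)
Lemma eigenvector_anisotropic (e : k) :
  e ^+ 2 = 1 -> eigenvalue T e ->
  exists2 v : 'rV_n.+1, v *m T = e *: v & (v *m B *m v^T) 0 0 != 0.
Proof.
move=> e2 /eigenvalueP[u uT u0].
have uTi : u *m Ti = e *: u.
  rewrite -[u in LHS]scale1r -e2 expr2 -scalerA -uT -scalemxAl -mulmxA TTi.
  by rewrite mulmx1.
have BuP : (T - e%:M) *m (B *m u^T) = 0.
  rewrite mulmxBl mulmxA -BTit -mulmxA -trmx_mul uTi linearZ /= mul_scalar_mx.
  by rewrite -scalemxAr subrr.
have Bu0 : B *m u^T != 0.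
  apply: contraNneq u0 => Bu.
  by rewrite -trmx_eq0 -(mulKmx unitB u^T) Bu mulmx0.
have [j Buj] : exists j, (B *m u^T) j 0 != 0.
  by have /matrix0Pn[j [l]] := Bu0; rewrite (ord1 l); exists j.
have [y pyp] := horner_mx_regular ('X - e%:P) sepT.
have PE : horner_mx T ('X - e%:P) = T - e%:M.
  by rewrite rmorphB /= horner_mx_X horner_mx_C.
(* The polynomial in [T] is the projection onto the eigenspace; it preserves the pairing with
   [u]. *)
pose x : 'rV_n.+1 := delta_mx 0 j *m horner_mx T (1 - y * ('X - e%:P)).
have xT : x *m T = e *: x.
  apply/eqP; rewrite -subr_eq0 -mul_mx_scalar -mulmxBr -PE -mulmxA.
  have -> : horner_mx T (1 - y * ('X - e%:P)) *m horner_mx T ('X - e%:P) =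
            horner_mx T ('X - e%:P - ('X - e%:P) * y * ('X - e%:P)).
    by rewrite -[LHS]rmorphM; congr (horner_mx T _); ring.
  by rewrite rmorphB /= pyp subrr mulmx0.
have xu : x *m B *m u^T = delta_mx 0 j *m (B *m u^T).
  rewrite -[LHS]mulmxA -mulmxA rmorphB rmorph1 rmorphM /= PE mulmxBl mul1mx.
  by rewrite -[_ * _]/(_ *m _) -(mulmxA _ (T - _)) BuP mulmx0 subr0.
have qxu : (x *m B *m u^T) 0 0 != 0 by rewrite xu -rowE mxE.
have [z zP qz] := polarization char_k symB qxu; exists z => //.
by move: zP; rewrite !inE => /or3P[]/eqP-> //; rewrite mulmxDl xT uT scalerDr.
Qed.

End InvertingInvolution.

(** * Determinants of centralizing isometries and of inverting involutions *)

Lemma det_centralizer (K : fieldType) n (B T C : 'M[K]_n) :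
    diagonalizable T -> B \in unitmx -> T *m B *m T^T = B ->
    C *m B *m C^T = B -> C *m T = T *m C ->
    ~~ eigenvalue T 1 -> ~~ eigenvalue T (-1) ->
  \det C = 1.
Proof.
case=> P unitP /diagonalizable_forPex[d /eqP PT] unitB isoT isoC comC.
have {}PT : P *m T *m invmx P = diag_mx d by rewrite -conjumx.
have PTE : P *m T = diag_mx d *m P by rewrite -PT mulmxKV.
pose C1 := P *m C *m invmx P; pose B1 := P *m B *m P^T.
have C1P : C1 *m P = P *m C by rewrite mulmxKV.
have evT i : eigenvalue T (d 0 i).
  apply/eigenvalueP; exists (row i P).
    by rewrite -row_mul PTE; apply/rowP=> j; rewrite mxE mul_diag_mx !mxE.
  apply/eqP=> Pi0; have /rowP/(_ i)/eqP : row i (P *m invmx P) = 0.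
    by rewrite row_mul Pi0 mul0mx.
  by rewrite mulmxV // !mxE eqxx oner_eq0.
move=> ev1 evN1; have -> : \det C = \det C1.
  by rewrite !det_mulmx mulrAC -det_mulmx mulmxV // det1 mul1r.
apply: (@det_centralizer_diag _ _ d B1) => [||||i].
- by rewrite !unitmx_mul unitP unitB unitmx_tr.
- rewrite -{2}[diag_mx d]tr_diag_mx /B1 !mulmxA -PTE -!mulmxA -trmx_mul -PTE.
  by rewrite trmx_mul !mulmxA -!(mulmxA P) isoT.
- rewrite /B1 !mulmxA C1P -!mulmxA -trmx_mul C1P trmx_mul !mulmxA.
  by rewrite -!(mulmxA P) isoC.
- by rewrite -PT /C1 !mulmxA !mulmxKV // -!(mulmxA P) comC.
rewrite sqrf_eq1 negb_or; apply/andP.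
by split; [move: ev1 | move: evN1]; apply: contraNneq => <-.
Qed.

Lemma det_orthogonal (k : fieldType) n (B S : 'M[k]_n) :
  B \in unitmx -> S *m B *m S^T = B -> (\det S == 1) || (\det S == -1).
Proof.
move=> unitB /(congr1 determinant); rewrite !det_mulmx det_tr mulrC mulrA => dS.
rewrite -sqrf_eq1 expr2; apply/eqP/(mulIf _ (etrans dS (esym (mul1r _)))).
by rewrite -unitfE -unitmxE.
Qed.

Section OrthogonalMatrix.

Variables (k : fieldType) (n : nat) (B T : 'M[k]_n.+1).
Hypotheses (char_k : 2%N \notin [pchar k]).
Hypotheses (unitB : B \in unitmx) (symB : B^T = B).
Hypotheses (unitT : T \in unitmx) (isoT : T *m B *m T^T = B).
Hypothesis sepT : separable_poly (mxminpoly T).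

Let TTi : T *m invmx T = 1%:M. Proof. exact: mulmxV. Qed.

Let self_adjoint_isometry S :
  B *m S^T = S *m B -> S *m S = 1%:M -> S *m B *m S^T = B.
Proof. by move=> SB SS; rewrite -mulmxA SB mulmxA SS mul1mx. Qed.

Lemma inverting_involution : exists S : 'M_n.+1,
  [/\ S *m S = 1%:M, S *m B *m S^T = B & T *m S *m T = S].
Proof.
have [|||S [_ _ SS SB TST]] :=
  @inverting_involution_on k n B T _ char_k unitB symB TTi isoT sepT 1%:M.
- by rewrite mulmx1.
- by rewrite trmx1 mulmx1 mul1mx.
- by rewrite mulmx1 mul1mx.
by exists S; rewrite self_adjoint_isometry.
Qed.

(* On an anisotropic line where [T] is [e], the involution may be chosen to be
   [1] or [-1]; these two choices have opposite determinants. *)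
Lemma inverting_involution_det1 (e : k) :
  e ^+ 2 = 1 -> eigenvalue T e -> exists S : 'M_n.+1,
  [/\ S *m S = 1%:M, S *m B *m S^T = B, T *m S *m T = S & \det S = 1].
Proof.
move=> e2 evT.
have [v vT qv] :=
  eigenvector_anisotropic char_k unitB symB TTi isoT sepT e2 evT.
set q := (v *m B *m v^T) 0 0 in qv.
have vBv : v *m B *m v^T = q%:M by rewrite [LHS]mx11_scalar.
(* The orthogonal projection onto the line of [v]. *)
pose F := q^-1 *: (B *m v^T *m v).
have vF : v *m F = v.
  by rewrite -scalemxAr !mulmxA vBv mul_scalar_mx scalerA mulVf // scale1r.
have FF : F *m F = F by rewrite {1}/F -scalemxAl -(mulmxA _ v) vF.
have FB : B *m F^T = F *m B.
  by rewrite linearZ /= -scalemxAr -scalemxAl !trmx_mul trmxK symB !mulmxA.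
have FT : F *m T = e *: F.
  by rewrite -scalemxAl -(mulmxA _ v) vT -scalemxAr scalerA mulrC -scalerA.
have TF : T *m F = e *: F.
  have BTt := esym (isometry_adjoint TTi isoT).
  have vTi : v *m invmx T = e *: v.
    by rewrite -[v in LHS]scale1r -e2 expr2 -scalerA -vT -scalemxAl mulmxK.
  rewrite -scalemxAr !mulmxA BTt -(mulmxA B) -trmx_mul vTi linearZ /=.
  by rewrite -scalemxAr -scalemxAl scalerA mulrC -scalerA.
have defF : F = q^-1 *: (B *m v^T *m v) by [].
clearbody F.
have TFT : T *m F *m T = F.
  by rewrite TF -scalemxAl FT scalerA -expr2 e2 scale1r.
have [|||S [FS SF SS SB TST]] :=
  @inverting_involution_on k n B T _ char_k unitB symB TTi isoT sepT (1%:M - F).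
- by rewrite mulmxBl mul1mx mulmxBr mulmx1 FF subrr subr0.
- by rewrite linearB /= mulmxBl mulmxBr trmx1 mulmx1 mul1mx FB.
- by rewrite mulmxBl mulmxBr mulmx1 mul1mx FT TF.
have SF0 : S *m F = 0 by rewrite -SF -mulmxA mulmxBl mul1mx FF subrr mulmx0.
have FS0 : F *m S = 0 by rewrite -FS mulmxA mulmxBr mulmx1 FF subrr mul0mx.
have Sb (b : bool) (Sb := S + (-1) ^+ b *: F) :
    [/\ Sb *m Sb = 1%:M, Sb *m B *m Sb^T = B & T *m Sb *m T = Sb].
  have SSb : Sb *m Sb = 1%:M.
    rewrite mulmxDl !mulmxDr -!scalemxAl -!scalemxAr SF0 FS0 SS FF !scaler0.
    by rewrite scalerA -expr2 sqrr_sign scale1r addr0 add0r subrK.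
  split=> //; last by rewrite mulmxDr mulmxDl TST -scalemxAr -scalemxAl TFT.
  apply: self_adjoint_isometry => //.
  by rewrite linearD linearZ /= mulmxDr mulmxDl SB -scalemxAr -scalemxAl FB.
have [SS0 iso0 TST0] := Sb false; have [SS1 iso1 TST1] := Sb true.
have [d0|d0] := orP (det_orthogonal unitB iso0).
  by exists (S + (-1) ^+ false *: F); split=> //; exact/eqP.
exists (S + (-1) ^+ true *: F); split=> //.
(* The second factor is [1 - 2 F], the reflection along [v], of determinant [-1]. *)
have -> : S + (-1) ^+ true *: F =
    (S + (-1) ^+ false *: F) *m (1%:M - (2 * q^-1) *: (B *m v^T) *m v).
  rewrite -scalemxAl -scalerA -defF mulmxBr mulmx1 -scalemxAr mulmxDl SF0.
  rewrite -scalemxAl FF add0r expr0 expr1 !scale1r scaleN1r.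
  by rewrite scaler_nat mulr2n opprD addrA addrK.
rewrite det_mulmx (eqP d0) det_1_sub_mul -scalemxAr mulmxA vBv !mxE eqxx mulr1n.
by rewrite mulfVK // mulN1r opprB; ring.
Qed.

End OrthogonalMatrix.

(** [T *m G *m T = G] encodes, without inverses, that [G] conjugates [T] to its inverse. *)
Lemma special_orthogonal_strongly_real (k : fieldType) (K : closedFieldType)
    (iota : {rmorphism k -> K}) n (B T G : 'M[k]_n) :
    2%N \notin [pchar k] -> B \in unitmx -> B^T = B ->
    T *m B *m T^T = B -> T \in unitmx -> diagonalizable (map_mx iota T) ->
    G *m B *m G^T = B -> \det G = 1 -> T *m G *m T = G ->
  exists S : 'M_n,
  [/\ S *m S = 1%:M, S *m B *m S^T = B, T *m S *m T = S & \det S = 1].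
Proof.
case: n => [|n] in B T G *.
  (* In dimension [0] all matrices coincide. *)
  by exists G; split=> //; rewrite [LHS]flatmx0 [RHS]flatmx0.
move=> char_k unitB symB isoT unitT diagT isoG detG TGT.
have sepT := separable_mxminpoly diagT.
have [ev1|ev1] := boolP (eigenvalue T 1).
  exact: inverting_involution_det1 (expr1n _ _) ev1.
have [evN1|evN1] := boolP (eigenvalue T (-1)).
  by apply: inverting_involution_det1 evN1 => //; rewrite sqrrN expr1n.
have [S [SS isoS TST]] :=
  inverting_involution char_k unitB symB unitT isoT sepT.
exists S; split=> //.
have comGS : G *m S *m T = T *m (G *m S).
  by rewrite -{1}TGT -!mulmxA (mulmxA T S) TST.
have isoGS : G *m S *m B *m (G *m S)^T = B.
  by rewrite trmx_mul !mulmxA -!(mulmxA G) isoS mulmxA.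
apply: (fmorph_inj iota); rewrite rmorph1.
have := @det_centralizer K _ (map_mx iota B) (map_mx iota T)
  (map_mx iota (G *m S)) diagT.
rewrite !matrix.map_trmx -!map_mxM isoT isoGS comGS map_unitmx det_map_mx.
rewrite det_mulmx detG mul1r; apply=> //.
  by rewrite -[1](rmorph1 iota) eigenvalue_map.
by rewrite -[1](rmorph1 iota) -rmorphN eigenvalue_map.
Qed.

(** * Translation between endomorphisms and matrices *)

Section Coordinates.

Variables (k : fieldType) (V : vectType k).
Implicit Types f g : 'End(V).
Let e := vbasis {:V}.
Let e_basis : basis_of {:V} e := vbasisP fullv.

Lemma end_mxK : cancel (@end_mx k V) (hommx e e).
Proof. exact: mxofK. Qed.

Lemma hommx_endK : cancel (hommx e e) (@end_mx k V).
Proof. exact: hommxK. Qed.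

Lemma end_mx_comp f g : end_mx (f \o g)%VF = end_mx g *m end_mx f.
Proof. exact: mxof_comp. Qed.

Lemma end_mx1 : end_mx (\1%VF : 'End(V)) = 1%:M.
Proof. exact/mxof1/(basis_free e_basis). Qed.

Lemma rVof_end f v : rVof e (f v) = rVof e v *m end_mx f.
Proof. by rewrite mul_mxof rVofK. Qed.

Lemma unit_end_mx f : end_mx f \in unitmx -> lker f == 0%VS.
Proof.
move=> unitf; apply/lker0P=> u v fuv; apply: (can_inj (rVofK e_basis)).
by apply: (can_inj (mulmxK unitf)); rewrite -!rVof_end fuv.
Qed.

Variable Q : V -> k.
Hypotheses (quadQ : quadratic_form Q) (char_k : 2%N \notin [pchar k]).

Definition gram_mx : 'M_(\dim {:V}) := \matrix_(i, j) polar Q e`_i e`_j.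

Lemma polarC u v : polar Q u v = polar Q v u.
Proof. by rewrite /polar (addrC u) addrAC. Qed.

Lemma polarPl a u v w : polar Q (a *: u + v) w = a * polar Q u w + polar Q v w.
Proof. by case: quadQ => _ [linl linr]; rewrite linl. Qed.

Lemma polar_gram u v :
  polar Q u v = (rVof e u *m gram_mx *m (rVof e v)^T) 0 0.
Proof.
have sumE (I : Type) (r : seq I) (a : I -> k) (x : I -> V) w :
    polar Q (\sum_(i <- r) a i *: x i) w = \sum_(i <- r) a i * polar Q (x i) w.
  elim: r => [|i r IHr]; last by rewrite !big_cons polarPl IHr.
  rewrite !big_nil; have := polarPl 1 0 0 w.
  by rewrite scale1r addr0 mul1r -{1}[polar Q 0 w]addr0 => /addrI.
rewrite {1}(coord_basis e_basis (memvf u)) {1}(coord_basis e_basis (memvf v)).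
rewrite sumE -mulmxA mxE; apply: eq_bigr => i _; rewrite mxE; congr (_ * _).
rewrite polarC sumE mxE; apply: eq_bigr => j _.
by rewrite !mxE mulrC polarC.
Qed.

Lemma gram_mx_sym : gram_mx^T = gram_mx.
Proof. by apply/matrixP=> i j; rewrite !mxE polarC. Qed.

Lemma polar_diag v : polar Q v v = 2 * Q v.
Proof.
case: quadQ => QZ _.
by rewrite /polar -[v + v]/(v *+ 2) -scaler_nat QZ; ring.
Qed.

Lemma gram_mx_unit : nondegenerate_form Q -> gram_mx \in unitmx.
Proof.
move=> ndQ; rewrite -row_free_unit -kermx_eq0; apply/rowV0P=> x /sub_kermxP xB.
apply/eqP; rewrite -(vecof_eq0 e_basis) //; apply/eqP/ndQ => v.
by rewrite polar_gram vecofK // xB mul0mx mxE.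
Qed.

(** In characteristic not [2], [polar_diag] recovers [Q] from its polar form. *)
Lemma isometry_gram g :
  (forall v, Q (g v) = Q v) <-> end_mx g *m gram_mx *m (end_mx g)^T = gram_mx.
Proof.
split=> [isog | isog v].
  apply/matrixP=> i j; rewrite [RHS]mxE.
  have -> : polar Q e`_i e`_j = polar Q (g e`_i) (g e`_j).
    by rewrite /polar -linearD !isog.
  pose delta l : 'rV[k]_(\dim {:V}) := delta_mx 0 l.
  have entry (A : 'M_(\dim {:V})) : A i j = (delta i *m A *m (delta j)^T) 0 0.
    by rewrite -rowE trmx_delta -colE !mxE.
  by rewrite entry polar_gram !rVof_end trmx_mul !rVofE ?e_basis // !mulmxA.
have n2 : 2 != 0 :> k by move: char_k; rewrite inE.
apply: (mulfI n2); rewrite -!polar_diag !polar_gram !rVof_end trmx_mul.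
by rewrite !mulmxA -!(mulmxA (rVof e v)) isog.
Qed.

End Coordinates.

(** * Real and strongly real elements of [SO(Q)] *)

Lemma comp_lfun_inv (k : fieldType) (V : vectType k) (f g : 'End(V)) :
  lker f == 0%VS -> (f \o g = \1)%VF -> (f^-1 = g)%VF.
Proof. by move=> kf fg; rewrite -[RHS](lker0_compKf kf) fg comp_lfun1r. Qed.

Theorem theorem3p4p6 (k : fieldType) (char_k : 2%N \notin [pchar k])
    (V : vectType k) (Q : V -> k) (quadQ : quadratic_form Q)
    (ndQ : nondegenerate_form Q)
    (t : 'End(V)) (SOt : special_orthogonal Q t) (sst : semisimple t) :
  real_in (special_orthogonal Q) t <-> strongly_real_in (special_orthogonal Q) t.
Proof.
have SO_ker f : special_orthogonal Q f -> lker f == 0%VS.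
  by case=> _ detf; apply: unit_end_mx; rewrite unitmxE detf unitr1.
have [isot dett] := SOt; have kert := SO_ker t SOt; split.
  case=> g SOg gtg; have [isog detg] := SOg; have kerg := SO_ker g SOg.
  (* Being a palindrome, this relation is insensitive to the reversal of products in
     [end_mx_comp]. *)
  have tgt : (t \o (g \o t) = g)%VF.
    by rewrite -(lker0_compfVK kerg (g \o t)%VF) gtg lker0_compVKf.
  have [K [iota [_ diagT]]] := sst.
  have [|||||||||S [SS isoS TST detS]] :=
      @special_orthogonal_strongly_real k K iota _ (gram_mx Q) (end_mx t)
        (end_mx g).
  - by [].
  - exact: gram_mx_unit.
  - exact: gram_mx_sym.
  - exact/isometry_gram.
  - by rewrite unitmxE dett unitr1.
  - by [].
  - exact/isometry_gram.
  - by [].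
  - by rewrite -[in RHS]tgt !end_mx_comp.
  have inj := can_inj (@end_mxK k V).
  pose s := hommx (vbasis {:V}) (vbasis {:V}) S.
  have sE : end_mx s = S by apply: hommx_endK.
  have SOs : special_orthogonal Q s.
    by split; [apply/isometry_gram; rewrite ?sE | rewrite sE].
  exists s, (s \o t)%VF; split.
  - by split=> //; apply: inj; rewrite end_mx_comp end_mx1 sE.
  - split; first split=> [v|].
    + by rewrite comp_lfunE; case: SOs => -> _.
    + by rewrite end_mx_comp det_mulmx dett sE detS mulr1.
    by apply: inj; rewrite !end_mx_comp end_mx1 sE mulmxA TST.
  by apply: inj; rewrite !end_mx_comp sE -mulmxA SS mulmx1.
case=> s1 [s2 [[SO1 inv1] [SO2 inv2] tE]]; exists s1 => //.
have -> : (s1^-1 = s1)%VF by apply: comp_lfun_inv => //; apply: SO_ker.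
have -> : (t^-1 = s2 \o s1)%VF.
  apply: comp_lfun_inv => //.
  by rewrite tE comp_lfunA -(comp_lfunA s1) inv2 comp_lfun1r.
by rewrite tE comp_lfunA inv1 comp_lfun1l.
Qed.
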